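(* Let $p$ be a prime. For any $p$-adic Möbius map $g\in\mathrm{PSL}(2,\mathbb{C}_p)$, there exists an element $u\in\mathrm{PSL}(2,\mathcal{O}_p)$ such that $g=uf$, where either $f$ is a loxodromic element with antipodal fixed points, or $f=I$.
   Context: $\mathbb{C}_p$ is the completion of the algebraic closure of $\mathbb{Q}_p$; $\mathcal{O}_p=\{z\in\mathbb{C}_p:|z|\le1\}$. A $p$-adic Möbius map is an element of $\mathrm{PSL}(2,\mathbb{C}_p)=\mathrm{SL}(2,\mathbb{C}_p)/\{\pm I\}$, acting on $\mathbb{P}^1(\mathbb{C}_p)=\mathbb{C}_p\cup\{\infty\}$ by $z\mapsto\frac{az+b}{cz+d}$. $\mathrm{PSL}(2,\mathcal{O}_p)$ is the subgroup of those elements whose lifts to $\mathrm{SL}(2,\mathbb{C}_p)$ have all entries in $\mathcal{O}_p$. An element of $\mathrm{PSL}(2,\mathbb{C}_p)$ is loxodromic if at least one of its eigenvalues has absolute value larger than $1$; it then has exactly two fixed points in $\mathbb{P}^1(\mathbb{C}_p)$. Two points $\alpha,\beta\in\mathbb{P}^1(\mathbb{C}_p)$ are antipodal if there exists $v\in\mathrm{PSL}(2,\mathcal{O}_p)$ such that $v(0)=\alpha$ and $v(\infty)=\beta$. *)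

(* Defs.v *)
From HB Require Import structures.
From mathcomp Require Import all_boot all_order all_algebra.
From mathcomp Require Import generic_quotient.
From mathcomp Require Import reals.

Set Implicit Arguments.
Unset Strict Implicit.
Unset Printing Implicit Defensive.

Import Order.TTheory GRing.Theory Num.Theory.

Local Open Scope ring_scope.
Local Open Scope quotient_scope.

(* The field C_p.  It is specified by the tower
     rat -> Q_p -> algebraic closure of Q_p -> C_p
   in which the first and last arrows are completions; these conditions
   determine C_p with its absolute value up to isometric isomorphism. *)

Definition padic_abs (R : realType) (p : nat) (x : rat) : R :=
  if x == 0 then 0
  else p%:R ^ ((logn p `|denq x|)%:Z - (logn p `|numq x|)%:Z).

Record nonarch_abs (R : realType) (K : fieldType) (v : K -> R) : Prop :=
  NonarchAbs {
    nonarch_abs_ge0 : forall x, 0 <= v x;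
    nonarch_abs_eq0 : forall x, v x = 0 <-> x = 0;
    nonarch_absM : forall x y, v (x * y) = v x * v y;
    nonarch_absD : forall x y, v (x + y) <= Num.max (v x) (v y)
  }.

Definition abs_complete (R : realType) (K : fieldType) (v : K -> R) : Prop :=
  forall u : nat -> K,
    (forall e : R, 0 < e -> exists N : nat, forall m n : nat,
       (N <= m)%N -> (N <= n)%N -> v (u m - u n) < e) ->
    exists l : K, forall e : R, 0 < e -> exists N : nat, forall n : nat,
       (N <= n)%N -> v (u n - l) < e.

Record is_completion (R : realType) (F K : fieldType) (v : F -> R) (w : K -> R)
    (i : {rmorphism F -> K}) : Prop := IsCompletion {
  completion_abs : nonarch_abs w;
  completion_extends : forall x, w (i x) = v x;
  completion_dense : forall (y : K) (e : R), 0 < e -> exists x, w (y - i x) < e;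
  completion_complete : abs_complete w
}.

Record is_algebraic_closure (F L : fieldType) (i : {rmorphism F -> L}) : Prop :=
  IsAlgebraicClosure {
    algebraic_closure_closed : GRing.closed_field_axiom L;
    algebraic_closure_algebraic : forall x : L, algebraicOver i x
  }.

Structure padicComplexField (R : realType) (p : nat) := PadicComplexField {
  Qp : fieldType;
  Qp_abs : Qp -> R;
  rat_to_Qp : {rmorphism rat -> Qp};
  Qp_completion : is_completion (padic_abs R p) Qp_abs rat_to_Qp;
  Qpbar : fieldType;
  Qpbar_abs : Qpbar -> R;
  Qp_to_Qpbar : {rmorphism Qp -> Qpbar};
  Qpbar_closure : is_algebraic_closure Qp_to_Qpbar;
  Qpbar_abs_nonarch : nonarch_abs Qpbar_abs;
  Qpbar_abs_extends : forall x, Qpbar_abs (Qp_to_Qpbar x) = Qp_abs x;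
  Cp_field :> fieldType;
  Cp_abs : Cp_field -> R;
  Qpbar_to_Cp : {rmorphism Qpbar -> Cp_field};
  Cp_completion : is_completion Qpbar_abs Cp_abs Qpbar_to_Cp
}.

Section SL2.
Variable K : fieldType.

Record SL2 := MkSL2 { SL2_mx :> 'M[K]_2; _ : \det SL2_mx == 1 }.

HB.instance Definition _ := [isSub for SL2_mx].
HB.instance Definition _ := [Choice of SL2 by <:].

Implicit Types A B D : SL2.

Lemma SL2_det A : \det A = 1. Proof. by case: A => M /= /eqP. Qed.

Fact SL2_one_subproof : \det (1%:M : 'M[K]_2) == 1.
Proof. by rewrite det1. Qed.
Definition SL2_one := MkSL2 SL2_one_subproof.

Fact SL2_mul_subproof A B : \det (A *m B) == 1.
Proof. by rewrite det_mulmx !SL2_det mul1r. Qed.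
Definition SL2_mul A B := MkSL2 (SL2_mul_subproof A B).

Fact SL2_inv_subproof A : \det (invmx A) == 1.
Proof. by rewrite det_inv SL2_det invr1. Qed.
Definition SL2_inv A := MkSL2 (SL2_inv_subproof A).

Fact SL2_opp_subproof A : \det (- SL2_mx A) == 1.
Proof. by rewrite -scaleN1r detZ SL2_det sqrrN expr1n mulr1. Qed.
Definition SL2_opp A := MkSL2 (SL2_opp_subproof A).

Lemma SL2_unit A : SL2_mx A \in unitmx.
Proof. by rewrite unitmxE SL2_det unitr1. Qed.

Fact SL2_mulA : associative SL2_mul.
Proof. by move=> A B D; apply/val_inj; rewrite /= mulmxA. Qed.

Fact SL2_mul1 : left_id SL2_one SL2_mul.
Proof. by move=> A; apply/val_inj; rewrite /= mul1mx. Qed.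

Fact SL2_mulr1 : right_id SL2_one SL2_mul.
Proof. by move=> A; apply/val_inj; rewrite /= mulmx1. Qed.

Fact SL2_mulV : left_inverse SL2_one SL2_inv SL2_mul.
Proof. by move=> A; apply/val_inj; rewrite /= mulVmx ?SL2_unit. Qed.

Fact SL2_mulrV : right_inverse SL2_one SL2_inv SL2_mul.
Proof. by move=> A; apply/val_inj; rewrite /= mulmxV ?SL2_unit. Qed.

HB.instance Definition _ :=
  isGroup.Build SL2 SL2_mulA SL2_mul1 SL2_mulr1 SL2_mulV SL2_mulrV.

Definition SL2_eqv : rel SL2 := fun A B => (A == B) || (A == SL2_opp B).

Lemma SL2_oppK : involutive SL2_opp.
Proof. by move=> A; apply/val_inj; rewrite /= opprK. Qed.

Fact SL2_eqv_refl : reflexive SL2_eqv.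
Proof. by move=> A; rewrite /SL2_eqv eqxx. Qed.

Fact SL2_eqv_sym : symmetric SL2_eqv.
Proof.
move=> A B; rewrite /SL2_eqv eq_sym; congr (_ || _).
by apply/eqP/eqP => ->; rewrite SL2_oppK.
Qed.

Fact SL2_eqv_trans : transitive SL2_eqv.
Proof.
move=> B A D /orP[]/eqP-> /orP[]/eqP->; rewrite /SL2_eqv ?SL2_oppK ?eqxx //.
all: by rewrite orbT.
Qed.

Canonical SL2_equiv := EquivRel SL2_eqv SL2_eqv_refl SL2_eqv_sym SL2_eqv_trans.

Definition PSL2 := {eq_quot SL2_eqv}.

HB.instance Definition _ := Choice.on PSL2.
HB.instance Definition _ := EqQuotient.on PSL2.

Implicit Types g h : PSL2.

Definition PSL2_one : PSL2 := \pi_PSL2 SL2_one.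
Definition PSL2_mul g h : PSL2 := \pi_PSL2 (SL2_mul (repr g) (repr h)).
Definition PSL2_inv g : PSL2 := \pi_PSL2 (SL2_inv (repr g)).

Lemma PSL2_eqP A B :
  reflect (A = B \/ A = SL2_opp B) (\pi_PSL2 A == \pi_PSL2 B).
Proof.
have -> : (\pi_PSL2 A == \pi_PSL2 B) = SL2_eqv A B by rewrite piE.
by apply: (iffP orP) => -[/eqP|/eqP]; [left|right|left|right].
Qed.

Lemma PSL2_reprP A : repr (\pi_PSL2 A) = A \/ repr (\pi_PSL2 A) = SL2_opp A.
Proof. by apply/PSL2_eqP; rewrite reprK. Qed.

Lemma PSL2_mulE A B : PSL2_mul (\pi_PSL2 A) (\pi_PSL2 B) = \pi_PSL2 (SL2_mul A B).
Proof.
apply/eqP/PSL2_eqP.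
case: (PSL2_reprP A) (PSL2_reprP B) => -> [] ->; [left|right|right|left] => //;
  by apply/val_inj; rewrite /= ?mulNmx ?mulmxN ?opprK.
Qed.

Lemma PSL2_invE A : PSL2_inv (\pi_PSL2 A) = \pi_PSL2 (SL2_inv A).
Proof.
apply/eqP/PSL2_eqP; case: (PSL2_reprP A) => ->; [by left|right].
apply/val_inj; rewrite /= -scaleN1r invmxZ ?invrN1 ?scaleN1r //.
exact: (SL2_unit (SL2_opp A)).
Qed.

Fact PSL2_mulA : associative PSL2_mul.
Proof.
move=> g h k; rewrite -(reprK g) -(reprK h) -(reprK k).
move: (repr g) (repr h) (repr k) => A B D.
by rewrite (PSL2_mulE A B) (PSL2_mulE B D) !PSL2_mulE SL2_mulA.
Qed.

Fact PSL2_mul1 : left_id PSL2_one PSL2_mul.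
Proof. by move=> g; rewrite -(reprK g) PSL2_mulE SL2_mul1. Qed.

Fact PSL2_mulr1 : right_id PSL2_one PSL2_mul.
Proof. by move=> g; rewrite -(reprK g) PSL2_mulE SL2_mulr1. Qed.

Fact PSL2_mulV : left_inverse PSL2_one PSL2_inv PSL2_mul.
Proof. by move=> g; rewrite -(reprK g) PSL2_invE PSL2_mulE SL2_mulV. Qed.

Fact PSL2_mulrV : right_inverse PSL2_one PSL2_inv PSL2_mul.
Proof. by move=> g; rewrite -(reprK g) PSL2_invE PSL2_mulE SL2_mulrV. Qed.

HB.instance Definition _ :=
  isGroup.Build PSL2 PSL2_mulA PSL2_mul1 PSL2_mulr1 PSL2_mulV PSL2_mulrV.

(* The projective line: [Some z] is the finite point z, [None] is infinity. *)
Definition P1 := option K.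

Definition mobius A (x : P1) : P1 :=
  let a := A 0 0 in let b := A 0 1 in let c := A 1 0 in let d := A 1 1 in
  match x with
  | Some z => if c * z + d == 0 then None else Some ((a * z + b) / (c * z + d))
  | None => if c == 0 then None else Some (a / c)
  end.

Definition PSL2_act g (x : P1) : P1 := mobius (repr g) x.

Lemma mobius_opp A x : mobius (SL2_opp A) x = mobius A x.
Proof.
have divNN (a b : K) : - a / - b = a / b by rewrite invrN mulrNN.
case: x => [z|] /=; rewrite !mxE.
  by rewrite !mulNr -!opprD oppr_eq0 divNN.
by rewrite oppr_eq0 divNN.
Qed.

Lemma PSL2_actE A x : PSL2_act (\pi_PSL2 A) x = mobius A x.
Proof. by rewrite /PSL2_act; case: (PSL2_reprP A) => ->; rewrite ?mobius_opp. Qed.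

Definition PSL2_eigenvalue g (a : K) : Prop :=
  exists A, \pi_PSL2 A = g /\ eigenvalue A a.

End SL2.

Section PadicMobius.
Variables (R : realType) (p : nat) (Cp : padicComplexField R p).

(* g belongs to PSL(2, O_p) *)
Definition PSL2_int (g : PSL2 Cp) : Prop :=
  forall A : SL2 Cp, \pi_(PSL2 Cp) A = g -> forall i j, Cp_abs (A i j) <= 1.

Definition loxodromic (g : PSL2 Cp) : Prop :=
  exists a : Cp, PSL2_eigenvalue g a /\ 1 < Cp_abs a.

Definition antipodal (x y : P1 Cp) : Prop :=
  exists v : PSL2 Cp,
    [/\ PSL2_int v, PSL2_act v (Some 0) = x & PSL2_act v None = y].

(* The set of fixed points of g is {x, y} with x and y antipodal
   (antipodal points are distinct). *)
Definition antipodal_fixed_points (g : PSL2 Cp) : Prop :=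
  exists x y : P1 Cp,
    (forall z : P1 Cp, PSL2_act g z = z <-> z = x \/ z = y) /\ antipodal x y.

End PadicMobius.

(* Main.v *)
Require Import Defs.
From mathcomp Require Import all_boot all_order all_algebra.
From mathcomp Require Import generic_quotient ring.
From mathcomp Require Import reals.

(** The theorem is a reading of the Cartan decomposition G = K A K, where
    G = SL(2) over a non-archimedean valued field, K is its subgroup of
    matrices with integral entries and A is the diagonal subgroup.

    If g = k1 d k2 with k1, k2 in K and d = diag(a, 1/a), then
      g = (k1 k2) (k2^-1 d k2).
    The first factor u is integral.  The second one, f, is conjugate to d, so
    a is an eigenvalue of f, and f fixes exactly the points that k2 sends to
    the fixed points 0 and infinity of d; these are v(0) and v(infinity) for
    v = k2^-1 in K, that is, antipodal.  Hence f is as wanted when |a| > 1.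
    When |a| <= 1 the matrix d is itself integral, so g is too, and one takes
    u = g and f = I.

    The decomposition [cartan_decomposition] is Gaussian elimination with
    complete pivoting: integral signed permutations bring an entry of largest
    absolute value to the upper left corner, and since all the ratios by this
    pivot are integral, the rest of its row and column is cleared by integral
    transvections.  The pivot stays an entry of largest absolute value, because
    by the ultrametric inequality multiplication by an integral matrix cannot
    increase a bound on the entries. *)

Set Implicit Arguments.
Unset Strict Implicit.
Unset Printing Implicit Defensive.

Import Order.TTheory GRing.Theory Num.Theory.

Local Open Scope ring_scope.
Local Open Scope quotient_scope.

(** * Two by two matrices *)

Lemma ord2P (i : 'I_2) : i = 0 \/ i = 1.
Proof.
by case: i => [[|[|//]] lt_i]; [left | right]; apply/val_inj.
Qed.

Lemma mulmx2E (R : pzSemiRingType) m n (A : 'M[R]_(m, 2)) (B : 'M[R]_(2, n)) i j :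
  (A *m B) i j = A i 0 * B 0 j + A i 1 * B 1 j.
Proof.
rewrite mxE big_ord_recl big_ord1; congr (_ + A i _ * B _ j); exact/val_inj.
Qed.

Lemma det_mx2 (R : comPzRingType) (A : 'M[R]_2) :
  \det A = A 0 0 * A 1 1 - A 0 1 * A 1 0.
Proof.
rewrite (expand_det_row _ 0) big_ord_recl big_ord1 /cofactor !det_mx11 !mxE /=.
have -> : lift 0 0 = 1 :> 'I_2 by apply/val_inj.
have -> : lift 1 0 = 0 :> 'I_2 by apply/val_inj.
by rewrite !addn0 addn1 expr0 expr1 mul1r mulN1r mulrN.
Qed.

Definition mx2 (K : fieldType) (a b c d : K) : 'M[K]_2 :=
  \matrix_(i, j) if i == 0 then if j == 0 then a else b
                 else if j == 0 then c else d.

Lemma det_mx2E (K : fieldType) (a b c d : K) :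
  \det (mx2 a b c d) = a * d - b * c.
Proof. by rewrite det_mx2 !mxE. Qed.

Lemma SL2_detE (K : fieldType) (A : SL2 K) : A 0 0 * A 1 1 - A 0 1 * A 1 0 = 1.
Proof. by rewrite -det_mx2 SL2_det. Qed.

Section ElementaryMatrices.
Variable K : fieldType.

Fact SL2_swap_subproof : \det (mx2 0 1 (- 1) 0 : 'M[K]_2) == 1.
Proof. by rewrite det_mx2E mul0r sub0r mulrN mulr1 opprK. Qed.

(** Sign change on one row makes the transposition unimodular. *)
Definition SL2_swap : SL2 K := MkSL2 SL2_swap_subproof.

Fact SL2_lower_subproof (x : K) : \det (mx2 1 0 x 1) == 1.
Proof. by rewrite det_mx2E mul1r mul0r subr0. Qed.
Definition SL2_lower x : SL2 K := MkSL2 (SL2_lower_subproof x).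

Fact SL2_upper_subproof (x : K) : \det (mx2 1 x 0 1) == 1.
Proof. by rewrite det_mx2E mul1r mulr0 subr0. Qed.
Definition SL2_upper x : SL2 K := MkSL2 (SL2_upper_subproof x).

End ElementaryMatrices.

(** * Ultrametric bounds on matrices *)

Section Nonarch.
Variables (R : realType) (K : fieldType) (v : K -> R).
Hypothesis vP : nonarch_abs v.

Lemma nonarch_abs0 : v 0 = 0.
Proof. exact/(nonarch_abs_eq0 vP). Qed.

Lemma nonarch_abs_gt0 x : x != 0 -> 0 < v x.
Proof.
move=> x0; rewrite lt_neqAle (nonarch_abs_ge0 vP) andbT eq_sym.
by apply: contra x0 => /eqP /(nonarch_abs_eq0 vP) ->.
Qed.

Lemma nonarch_abs1 : v 1 = 1.
Proof.
have v1 := nonarch_abs_gt0 (oner_neq0 K).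
by apply: (mulfI (lt0r_neq0 v1)); rewrite -(nonarch_absM vP) !mulr1.
Qed.

Lemma nonarch_absN x : v (- x) = v x.
Proof.
have vN1 : v (- 1) = 1.
  apply/eqP; rewrite -(pexpr_eq1 (n := 2)) ?(nonarch_abs_ge0 vP) //.
  by rewrite expr2 -(nonarch_absM vP) mulrNN mulr1 nonarch_abs1.
by rewrite -mulN1r (nonarch_absM vP) vN1 mul1r.
Qed.

Lemma nonarch_absV x : v x^-1 = (v x)^-1.
Proof.
have [->|x0] := eqVneq x 0; first by rewrite invr0 nonarch_abs0 invr0.
apply: (mulfI (lt0r_neq0 (nonarch_abs_gt0 x0))).
rewrite -(nonarch_absM vP) !divff ?nonarch_abs1 //.
exact: lt0r_neq0 (nonarch_abs_gt0 x0).
Qed.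

Definition entries_le m n (M : R) (A : 'M[K]_(m, n)) :=
  forall i j, v (A i j) <= M.

Lemma entries_leM m n M N (A : 'M[K]_(m, 2)) (B : 'M[K]_(2, n)) :
  entries_le M A -> entries_le N B -> entries_le (M * N) (A *m B).
Proof.
move=> leA leB i j; rewrite mulmx2E (le_trans (nonarch_absD vP _ _)) //.
by rewrite ge_max !(nonarch_absM vP) !ler_pM ?(nonarch_abs_ge0 vP).
Qed.

Lemma entries_le_mul1 m n M (A : 'M[K]_(m, 2)) (B : 'M[K]_(2, n)) :
  entries_le 1 A -> entries_le M B -> entries_le M (A *m B).
Proof. by move=> leA leB; rewrite -[M]mul1r; apply: entries_leM. Qed.

Lemma entries_le_mulr1 m n M (A : 'M[K]_(m, 2)) (B : 'M[K]_(2, n)) :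
  entries_le M A -> entries_le 1 B -> entries_le M (A *m B).
Proof. by move=> leA leB; rewrite -[M]mulr1; apply: entries_leM. Qed.

Lemma entries_le_mx2 M a b c d : v a <= M -> v b <= M -> v c <= M -> v d <= M ->
  entries_le M (mx2 a b c d).
Proof. by move=> ? ? ? ? i j; rewrite mxE; do 2!case: ifP. Qed.

Lemma entries_le1_one : entries_le 1 (SL2_one K).
Proof.
move=> i j; rewrite mxE; case: (i == j); first by rewrite nonarch_abs1.
by rewrite nonarch_abs0 ler01.
Qed.

(** For determinant 1 the inverse is the adjugate, whose entries are those of
    the matrix up to sign. *)
Lemma entries_le_inv M (A : SL2 K) : entries_le M A -> entries_le M (SL2_inv A).
Proof.
move=> leA i j; rewrite /= /invmx SL2_unit SL2_det invr1 scale1r mxE /cofactor.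
by rewrite det_mx11 !mxE -signr_odd; case: odd; rewrite ?mul1r ?mulN1r ?nonarch_absN.
Qed.

Lemma entries_le1_swap : entries_le 1 (SL2_swap K).
Proof.
by apply: entries_le_mx2; rewrite ?nonarch_absN ?nonarch_abs0 ?nonarch_abs1 ?ler01.
Qed.

Lemma entries_le1_lower x : v x <= 1 -> entries_le 1 (SL2_lower x).
Proof.
by move=> ?; apply: entries_le_mx2; rewrite ?nonarch_abs0 ?nonarch_abs1 ?ler01.
Qed.

Lemma entries_le1_upper x : v x <= 1 -> entries_le 1 (SL2_upper x).
Proof.
by move=> ?; apply: entries_le_mx2; rewrite ?nonarch_abs0 ?nonarch_abs1 ?ler01.
Qed.

(** * Cartan decomposition *)

Lemma row_to_top i : exists s : SL2 K,
  entries_le 1 s /\ forall n (A : 'M[K]_(2, n)) j, (s *m A) 0 j = A i j.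
Proof.
case: (ord2P i) => ->; [exists (SL2_one K) | exists (SL2_swap K)]; split.
- exact: entries_le1_one.
- by move=> n A j; rewrite mul1mx.
- exact: entries_le1_swap.
- by move=> n A j; rewrite mulmx2E !mxE /= mul0r mul1r add0r.
Qed.

Lemma col_to_left j : exists s : SL2 K,
  entries_le 1 s /\ forall m (A : 'M[K]_(m, 2)) i, (A *m s) i 0 = A i j.
Proof.
case: (ord2P j) => ->; [exists (SL2_one K) | exists (SL2_opp (SL2_swap K))]; split.
- exact: entries_le1_one.
- by move=> m A i; rewrite mulmx1.
- by move=> i k; rewrite mxE nonarch_absN; apply: entries_le1_swap.
- by move=> m A i; rewrite mulmx2E !mxE /= oppr0 opprK mulr0 mulr1 add0r.
Qed.

(** An entry of largest absolute value cannot vanish, since the determinant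
    would vanish with it. *)
Lemma SL2_max_entry (A : SL2 K) : exists i j, A i j != 0 /\ entries_le (v (A i j)) A.
Proof.
pose F (ij : 'I_2 * 'I_2) := v (A ij.1 ij.2).
have [[i j] _ maxF] := arg_maxP (P := xpredT) (i0 := (0, 0)) F isT.
have leA : entries_le (v (A i j)) A by move=> k l; apply: (maxF (k, l)).
exists i, j; split=> //; apply/eqP => Aij0.
have A0 k l : A k l = 0.
  apply/(nonarch_abs_eq0 vP)/eqP; rewrite eq_le (nonarch_abs_ge0 vP) andbT.
  by have := leA k l; rewrite Aij0 nonarch_abs0.
by have /esym/eqP := SL2_detE A; rewrite !A0 mulr0 subr0 oner_eq0.
Qed.

(** The multipliers used to clear the row and the column of the pivot are
    quotients by an entry of largest absolute value, hence integral. *)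
Lemma clear_pivot (B : SL2 K) : B 0 0 != 0 -> entries_le (v (B 0 0)) B ->
  exists l r : SL2 K, let D := SL2_mul (SL2_mul l B) r in
  [/\ entries_le 1 l, entries_le 1 r, D 0 1 = 0, D 1 0 = 0 & D 0 0 = B 0 0].
Proof.
move=> a0 leB; have a_gt0 := nonarch_abs_gt0 a0.
have ratio i j : v (- (B i j / B 0 0)) <= 1.
  by rewrite nonarch_absN (nonarch_absM vP) nonarch_absV ler_pdivrMr ?mul1r.
exists (SL2_lower (- (B 1 0 / B 0 0))), (SL2_upper (- (B 0 1 / B 0 0))).
move=> D; split; rewrite {}/D /= ?mulmx2E ?mxE /=; try by field.
- exact: entries_le1_lower.
- exact: entries_le1_upper.
Qed.

Lemma cartan_decomposition (A : SL2 K) : exists k1 d k2 : SL2 K,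
  [/\ A = SL2_mul (SL2_mul k1 d) k2, entries_le 1 k1, entries_le 1 k2,
      d 0 1 = 0 /\ d 1 0 = 0 & entries_le (v (d 0 0)) d].
Proof.
have [i [j [Aij0 leA]]] := SL2_max_entry A.
have [s [s_int sE]] := row_to_top i; have [t [t_int tE]] := col_to_left j.
pose B := SL2_mul (SL2_mul s A) t.
have B00 : B 0 0 = A i j by rewrite tE sE.
have leB : entries_le (v (B 0 0)) B.
  by rewrite B00; apply/entries_le_mulr1/t_int/entries_le_mul1.
have B00_neq0 : B 0 0 != 0 by rewrite B00.
have [l [r /= [l_int r_int D01 D10 D00]]] := clear_pivot B00_neq0 leB.
exists (SL2_inv (SL2_mul l s)), (SL2_mul (SL2_mul l B) r), (SL2_inv (SL2_mul t r)).
split=> //.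
- have -> : SL2_mul (SL2_mul l B) r = SL2_mul (SL2_mul (SL2_mul l s) A) (SL2_mul t r).
    by rewrite /B !SL2_mulA.
  move: (SL2_mul l s) (SL2_mul t r) => L T.
  by rewrite !SL2_mulA SL2_mulV SL2_mul1 -!SL2_mulA SL2_mulrV SL2_mulr1.
- exact/entries_le_inv/entries_le_mul1.
- exact/entries_le_inv/entries_le_mul1.
- rewrite [X in v X]D00.
  by apply/entries_le_mulr1/r_int/entries_le_mul1.
Qed.

End Nonarch.

(** * Action on the projective line *)

Section Action.
Variable K : fieldType.
Implicit Types A B : SL2 K.

(** The point with homogeneous coordinates [x : y], meaningful when they are
    not both zero. *)
Definition P1_point (x y : K) : P1 K := if y == 0 then None else Some (x / y).

Lemma P1_pointP (z : P1 K) : exists x y,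
  ((x != 0) || (y != 0)) /\ z = P1_point x y.
Proof.
case: z => [z|]; [exists z, 1 | exists 1, 0]; rewrite /P1_point ?oner_eq0 /=.
  by rewrite orbT divr1.
by rewrite eqxx.
Qed.

(** In homogeneous coordinates a Moebius map is linear, which avoids the case
    distinctions on infinity. *)
Lemma mobius_point A (x y : K) : (x != 0) || (y != 0) ->
  mobius A (P1_point x y) =
  P1_point (A 0 0 * x + A 0 1 * y) (A 1 0 * x + A 1 1 * y).
Proof.
rewrite /P1_point; have [-> /=|y0 _ /=] := eqVneq y 0.
  rewrite orbF !mulr0 !addr0 => x0; rewrite mulf_eq0 (negPf x0) orbF.
  by case: eqP => // /eqP c0; congr Some; field; rewrite ?c0 ?x0.
have -> : A 1 0 * (x / y) + A 1 1 = (A 1 0 * x + A 1 1 * y) / y by field.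
rewrite mulf_eq0 invr_eq0 (negPf y0) orbF.
by case: eqP => // /eqP e0; congr Some; field; rewrite y0 e0.
Qed.

Lemma SL2_point_neq0 A (x y : K) : (x != 0) || (y != 0) ->
  (A 0 0 * x + A 0 1 * y != 0) || (A 1 0 * x + A 1 1 * y != 0).
Proof.
apply: contraLR; rewrite !negb_or !negbK => /andP[/eqP e0 /eqP e1].
have dA := SL2_detE A.
have xE : x = A 1 1 * (A 0 0 * x + A 0 1 * y) - A 0 1 * (A 1 0 * x + A 1 1 * y).
  by rewrite -[LHS]mul1r -dA; ring.
have yE : y = A 0 0 * (A 1 0 * x + A 1 1 * y) - A 1 0 * (A 0 0 * x + A 0 1 * y).
  by rewrite -[LHS]mul1r -dA; ring.
by move: xE yE; rewrite e0 e1 !mulr0 subr0 => -> ->; rewrite eqxx.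
Qed.

Lemma mobiusM A B z : mobius (SL2_mul A B) z = mobius A (mobius B z).
Proof.
have [x [y [xy0 ->]]] := P1_pointP z.
rewrite !mobius_point ?SL2_point_neq0 // !mulmx2E.
by congr P1_point; ring.
Qed.

Lemma mobius1 z : mobius (SL2_one K) z = z.
Proof.
have [x [y [xy0 ->]]] := P1_pointP z.
by rewrite mobius_point // !mxE /= !mul1r !mul0r addr0 add0r.
Qed.

Lemma mobiusK A : cancel (mobius A) (mobius (SL2_inv A)).
Proof. by move=> z; rewrite -mobiusM SL2_mulV mobius1. Qed.

Lemma mobiusVK A : cancel (mobius (SL2_inv A)) (mobius A).
Proof. by move=> z; rewrite -mobiusM SL2_mulrV mobius1. Qed.

(** As d 1 1 is the inverse of d 0 0, the map is z |-> (d 0 0)^2 z. *)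
Lemma mobius_diag_fix (d : SL2 K) z : d 0 1 = 0 -> d 1 0 = 0 -> d 0 0 ^+ 2 != 1 ->
  mobius d z = z <-> z = Some 0 \/ z = None.
Proof.
move=> d01 d10 a2; have := SL2_detE d; rewrite d01 mul0r subr0 => ad1.
have d11_neq0 : d 1 1 != 0.
  by apply/eqP=> e0; move/esym/eqP: ad1; rewrite e0 mulr0 oner_eq0.
split=> [|[]->] /=; rewrite ?d10 ?eqxx //; last first.
  by rewrite d01 !mulr0 !add0r (negPf d11_neq0) mul0r.
case: z => [z|] /=; last by right.
rewrite d10 d01 mul0r add0r addr0 (negPf d11_neq0) => -[e]; left.
have {}e : d 0 0 ^+ 2 * z = z.
  have d11V : (d 1 1)^-1 = d 0 0 by apply: (mulIf d11_neq0); rewrite mulVf.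
  by rewrite -[RHS]e d11V; ring.
congr Some; apply/eqP; have /eqP : (d 0 0 ^+ 2 - 1) * z = 0.
  by rewrite mulrBl e mul1r subrr.
by rewrite mulf_eq0 subr_eq0 (negPf a2).
Qed.

(** The first row of k is a left eigenvector. *)
Lemma eigenvalue_conj_diag (k d : SL2 K) : d 0 1 = 0 ->
  eigenvalue (SL2_mul (SL2_mul (SL2_inv k) d) k) (d 0 0).
Proof.
move=> d01; apply/eigenvalueP; exists (row 0 k).
  rewrite rowE /= !mulmxA mulmxK ?SL2_unit //.
  have -> : delta_mx 0 0 *m d = d 0 0 *: delta_mx 0 0 :> 'rV_2.
    apply/rowP => j; rewrite -rowE !mxE.
    by case: (ord2P j) => ->; rewrite ?d01 /= ?mulr1 ?mulr0.
  by rewrite scalemxAl.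
apply/eqP => k0; move/esym/eqP: (SL2_detE k).
have k0j j : k 0 j = 0 by move/rowP/(_ j): k0; rewrite !mxE.
by rewrite !k0j !mul0r subr0 oner_eq0.
Qed.

End Action.

(** * Factorization of p-adic Moebius maps *)

Section PadicFactorization.
Variables (R : realType) (p : nat) (Cp : padicComplexField R p).

Let absP : nonarch_abs (@Cp_abs R p Cp) := completion_abs (Cp_completion Cp).

Lemma PSL2_int_pi (A : SL2 Cp) :
  entries_le (@Cp_abs R p Cp) 1 A -> PSL2_int (\pi_(PSL2 Cp) A).
Proof.
move=> leA B /eqP /PSL2_eqP[->|-> i j]; first exact: leA.
by rewrite mxE (nonarch_absN absP).
Qed.

Lemma loxodromic_conj_diag (k d : SL2 Cp) : d 0 1 = 0 -> 1 < Cp_abs (d 0 0) ->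
  loxodromic (\pi_(PSL2 Cp) (SL2_mul (SL2_mul (SL2_inv k) d) k)).
Proof.
move=> d01 a_gt1; exists (d 0 0); split=> //.
eexists; split; [by [] | exact: eigenvalue_conj_diag].
Qed.

(** The fixed points are the images under k^-1 of those of d, 0 and infinity;
    k^-1 is integral because k is. *)
Lemma antipodal_conj_diag (k d : SL2 Cp) : entries_le (@Cp_abs R p Cp) 1 k ->
    d 0 1 = 0 -> d 1 0 = 0 -> 1 < Cp_abs (d 0 0) ->
  antipodal_fixed_points (\pi_(PSL2 Cp) (SL2_mul (SL2_mul (SL2_inv k) d) k)).
Proof.
move=> k_int d01 d10 a_gt1; have a2 : d 0 0 ^+ 2 != 1.
  apply: contraTneq a_gt1 => a2; rewrite -leNgt.
  rewrite -(ler_pXn2r (n := 2)) ?nnegrE ?(nonarch_abs_ge0 absP) ?ler01 //.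
  by rewrite expr1n expr2 -(nonarch_absM absP) -expr2 a2 (nonarch_abs1 absP).
exists (mobius (SL2_inv k) (Some 0)), (mobius (SL2_inv k) None); split.
  move=> z; rewrite PSL2_actE !mobiusM.
  have fixE : mobius (SL2_inv k) (mobius d (mobius k z)) = z <->
      mobius d (mobius k z) = mobius k z.
    by split=> [{2}<-|->]; rewrite ?mobiusVK ?mobiusK.
  rewrite fixE mobius_diag_fix //; split=> -[] e; [left|right|left|right].
  - by rewrite -e mobiusK.
  - by rewrite -e mobiusK.
  - by rewrite e mobiusVK.
  - by rewrite e mobiusVK.
exists (\pi_(PSL2 Cp) (SL2_inv k)); rewrite !PSL2_actE; split=> //.
exact/PSL2_int_pi/(entries_le_inv absP).
Qed.

End PadicFactorization.

Theorem theorem1p4 (R : realType) (p : nat) (p_prime : prime p)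
    (Cp : padicComplexField R p) (g : PSL2 Cp) :
  exists u f : PSL2 Cp,
    [/\ PSL2_int u, g = (u * f)%g &
        (loxodromic f /\ antipodal_fixed_points f) \/ f = 1%g].
Proof.
have absP : nonarch_abs (@Cp_abs R p Cp) := completion_abs (Cp_completion Cp).
rewrite -[g]reprK; move: (repr g) => A.
have [k1 [d [k2 [-> k1_int k2_int [d01 d10] led]]]] := cartan_decomposition absP A.
have [a_le1|a_gt1] := leP (Cp_abs (d 0 0)) 1.
  exists (\pi_(PSL2 Cp) (SL2_mul (SL2_mul k1 d) k2)), 1%g.
  split; [|by rewrite mulg1 | by right].
  apply: PSL2_int_pi; apply: (entries_le_mul1 absP) k2_int.
  apply: (entries_le_mul1 absP) => // i j.
  exact: le_trans (led i j) a_le1.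
exists (\pi_(PSL2 Cp) (SL2_mul k1 k2)).
exists (\pi_(PSL2 Cp) (SL2_mul (SL2_mul (SL2_inv k2) d) k2)); split.
- by apply: PSL2_int_pi; apply: (entries_le_mul1 absP).
- rewrite -[RHS]/(PSL2_mul _ _) PSL2_mulE !SL2_mulA.
  by rewrite -[SL2_mul (SL2_mul k1 k2) _]SL2_mulA SL2_mulrV SL2_mulr1.
- by left; split; [apply: loxodromic_conj_diag | apply: antipodal_conj_diag].
Qed.
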